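(* Let $d\ge2$, $1\le k\le d$ and integers $u_1,\dots,u_d\ge2$ be fixed, let $\mathscr{P}=\prod_{j=1}^d\{1,\dots,u_j\}$, $u=\prod_{j=1}^d u_j$, let $\mathbf{p}_1,\dots,\mathbf{p}_n$ be independent uniform points on $\mathscr{P}$, and let $M^{[c]}_{d,k}(n)$ be the number of indices $i$ such that $\mathbf{p}_i$ is not $k$-dominated by any $\mathbf{p}_\ell$, $\ell\neq i$. Then the distribution of $M^{[c]}_{d,k}(n)$ is asymptotically equivalent to the binomial distribution with parameters $n$ and $1/u$: if $X_n\sim\mathrm{Binomial}(n,1/u)$, then $\sup_{A\subseteq\mathbb{Z}}\left|\mathbb{P}(M^{[c]}_{d,k}(n)\in A)-\mathbb{P}(X_n\in A)\right|\to0$ as $n\to\infty$.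
   Context: For points $\mathbf{p}=(p_1,\dots,p_d)$, $\mathbf{q}=(q_1,\dots,q_d)$, $\mathbf{p}$ $k$-dominates $\mathbf{q}$ if there is a set $S$ of $k$ coordinates such that $p_j\le q_j$ for all $j\in S$ and $p_j<q_j$ for at least one $j\in S$. *)

(* Defs.v *)
From HB Require Import structures.
From mathcomp Require Import all_boot all_order all_algebra.
From mathcomp Require Import all_classical all_reals all_analysis.

Set Implicit Arguments.
Unset Strict Implicit.
Unset Printing Implicit Defensive.

Import Order.TTheory GRing.Theory Num.Theory.
Import numFieldNormedType.Exports.

Local Open Scope classical_set_scope.
Local Open Scope ring_scope.

Definition kdominates (d k : nat) (p q : 'I_d -> nat) : bool :=
  [exists S : {set 'I_d}, [&& #|S| == k,
     [forall j in S, (p j <= q j)%N] & [exists j in S, (p j < q j)%N]]].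

(* The j-th factor {1, ..., u j} is carried by 'I_(u j), whose elements are
   numbered from 0; [grid_coord] recovers the value in {1, ..., u j}. *)
Definition grid (d : nat) (u : 'I_d -> nat) : finType :=
  {dffun forall j : 'I_d, 'I_(u j)}.

Definition grid_coord (d : nat) (u : 'I_d -> nat) (q : grid u) (j : 'I_d) : nat :=
  (q j).+1.

Definition nb_knondominated (d k n : nat) (u : 'I_d -> nat) (q : 'I_n -> grid u) : nat :=
  #|[set i : 'I_n | [forall l : 'I_n,
      (l != i) ==> ~~ kdominates k (grid_coord (q l)) (grid_coord (q i))]]%SET|.

Section finite_valued_random_elements.
Context (disp : measure_display) (T : measurableType disp) (R : realType).
Context (P : probability T R) (F : finType).

(* F carries the discrete sigma-algebra. *)
Definition random_element (X : T -> F) : Prop :=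
  forall B : set F, measurable (X @^-1` B).

Definition uniformly_distributed (X : T -> F) : Prop :=
  forall x : F, P (X @^-1` [set x]) = (#|F|%:R^-1)%:E.

Definition mutually_independent (n : nat) (X : 'I_n -> T -> F) : Prop :=
  forall (J : {set 'I_n}) (B : 'I_n -> set F),
    P (\bigcap_(i in [set` J]) (X i @^-1` B i)) =
    (\prod_(i in J) P (X i @^-1` B i))%E.

End finite_valued_random_elements.

(* Main.v *)
(** The minimal point [m = (1, ..., 1)] of the grid is never k-dominated and
    k-dominates every other point. Hence, as soon as [m] occurs in the sample,
    the k-nondominated points are exactly the occurrences of [m], whose number is
    Binomial(n, 1/u). The total variation distance is therefore at most the
    probability [(1 - 1/u)^n] that [m] does not occur. *)
Require Import Defs.
From HB Require Import structures.
From mathcomp Require Import all_boot all_order all_algebra.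
From mathcomp Require Import all_classical all_reals all_analysis.
From mathcomp Require Import lra.

Import Order.TTheory GRing.Theory Num.Theory.
Import numFieldNormedType.Exports.

Local Open Scope classical_set_scope.
Local Open Scope ring_scope.

Set Implicit Arguments.
Unset Strict Implicit.

(** * Finite-valued random elements and the binomial law of hit counts *)

Section finite_valued_random_elements.
Context (disp : measure_display) (T : measurableType disp) (R : realType).
Context (P : probability T R).

(** As [F] is finite, the preimage of any [B] is a finite union, over [f] in [B], of finite
    intersections of coordinate events. This makes every statistic of the whole sample
    measurable. *)
Lemma random_element_joint (F : finType) (n : nat) (X : 'I_n -> T -> F) :
  (forall i, random_element (X i)) ->
  random_element (fun t => [ffun i => X i t]).
Proof.
move=> mX B.
have -> : (fun t => [ffun i => X i t]) @^-1` B =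
    \bigcup_(f in B) \bigcap_(i in [set: 'I_n]) (X i @^-1` [set f i]).
  apply/seteqP; split=> [t Bt|t [f Bf ft]] /=.
    by exists [ffun i => X i t] => // i _; rewrite ffunE.
  suff -> : [ffun i => X i t] = f by [].
  by apply/ffunP => i; rewrite ffunE; exact: ft.
apply: fin_bigcup_measurable; first exact: finite_finset.
move=> f _; apply: fin_bigcap_measurable; first exact: finite_finset.
by move=> i _; exact: mX.
Qed.

Lemma random_element_comp (F G : finType) (h : F -> G) (X : T -> F) :
  random_element X -> random_element (h \o X).
Proof. by move=> mX B; rewrite comp_preimage; exact: mX. Qed.

Lemma probability_finite_sum (G : finType) (Y : T -> G) (B : set G) :
  random_element Y ->
  P (Y @^-1` B) = (\sum_(y : G | y \in B) P (Y @^-1` [set y]))%E.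
Proof.
move=> mY.
have -> : Y @^-1` B = \bigcup_(y in B) (Y @^-1` [set y]).
  by apply/seteqP; split=> [t Bt|t [y By /= Yt]] /=; [exists (Y t)|rewrite Yt].
rewrite measure_fin_bigcup; [|exact: finite_finset| |by move=> y _; exact: mY].
- rewrite [RHS](bigfs _ (index_enum_uniq _)).
    by apply: eq_fsbigl; rewrite set_mem_set.
  by move=> y _; rewrite mem_index_enum.
- by move=> y z _ _ [t [/= <- <-]].
Qed.

(** Coupling inequality: the parts outside [C] cancel, and what remains is the difference of two
    numbers lying in [[0, P C]]. *)
Lemma probability_dist_le (A B C : set T) :
  measurable A -> measurable B -> measurable C ->
  A `\` C = B `\` C -> (`|P A - P B| <= P C)%E.
Proof.
move=> mA mB mC AB.
have fin S : measurable S -> exists x : R, P S = x%:E.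
  by move=> mS; exists (fine (P S)); rewrite fineK// fin_num_measure.
have part S : measurable S ->
    [/\ (0 <= P (S `&` C))%E, (P (S `&` C) <= P C)%E &
        P S = (P (S `\` C) + P (S `&` C))%E].
  move=> mS; split; [exact: measure_ge0| |exact: measureDI].
  apply: le_measure; rewrite ?inE; [exact: measurableI| |exact: subIsetr].
  exact: mC.
have [A0 AC ->] := part _ mA; have [B0 BC ->] := part _ mB; rewrite AB.
have [x ->] := fin _ (measurableD mB mC).
move: A0 AC B0 BC; have [y ->] := fin _ (measurableI _ _ mA mC).
have [z ->] := fin _ (measurableI _ _ mB mC); have [w ->] := fin _ mC.
rewrite -!EFinD abse_EFin !lee_fin => y0 yw z0 zw.
rewrite ler_norml; apply/andP; split; lra.
Qed.

(** Prescribing the hit set prescribes for each [i] whether [X i] falls in [b] or in its complement;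
    independence turns this intersection into a product with a factor [r] on [J] and [1 - r] off
    [J]. *)
Lemma hit_set_probability (F : finType) (n : nat) (X : 'I_n -> T -> F)
    (b : pred F) (r : R) (J : {set 'I_n}) :
  (forall i, random_element (X i)) -> mutually_independent P X ->
  (forall i, P (X i @^-1` [set` b]) = r%:E) ->
  P [set t | [set i | b (X i t)]%SET = J] = (r ^+ #|J| * (1 - r) ^+ (n - #|J|))%:E.
Proof.
move=> mX indX Xr.
have -> : [set t | [set i | b (X i t)]%SET = J] =
  \bigcap_(i in [set` [set: 'I_n]%SET])
     (X i @^-1` (if i \in J then [set` b] else ~` [set` b])).
  apply/seteqP; split=> [t <- i _|t tJ] /=.
    by rewrite inE; case: ifP => // /negbT/negP.
  apply/setP => i; rewrite inE; have := tJ i; rewrite /= inE => /(_ isT).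
  by case: ifP => //= _ /negP/negbTE.
rewrite indX (eq_bigr (fun i => (if i \in J then r else 1 - r)%:E)); last first.
  move=> i _; case: ifP => _; first exact: Xr.
  by rewrite preimage_setC probability_setC ?Xr; [|exact: (mX i [set` b])].
rewrite prodEFin; congr EFin.
rewrite (eq_bigl xpredT) => [|i]; last by rewrite inE.
rewrite (bigID (mem J)) /=; congr (_ * _).
  by rewrite (eq_bigr (fun=> r)) ?prodr_const// => i ->.
rewrite (eq_bigr (fun=> 1 - r)) => [|i /negbTE -> //].
rewrite (eq_bigl (mem (~: J)%SET)) => [|i]; last by rewrite !inE.
by rewrite prodr_const cardsCs finset.setCK card_ord.
Qed.

(** Sum the probabilities of the hit sets [J] with [#|J|] in [A], grouped by cardinality: the
    binomial coefficient counts the [J] of each size. *)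
Lemma hit_count_binomial (F : finType) (n : nat) (X : 'I_n -> T -> F)
    (b : pred F) (r : R) (A : set nat) :
  0 <= r <= 1 ->
  (forall i, random_element (X i)) -> mutually_independent P X ->
  (forall i, P (X i @^-1` [set` b]) = r%:E) ->
  P [set t | A #|[set i | b (X i t)]%SET|] = binomial_prob n r A.
Proof.
move=> /andP[r0 r1] mX indX Xr.
have mS : random_element (fun t => [set i | b (X i t)]%SET).
  have := random_element_comp (fun f : {ffun 'I_n -> F} => [set i | b (f i)]%SET)
    (random_element_joint mX).
  congr random_element; apply/funext => t /=.
  by apply/setP => i; rewrite !inE ffunE.
rewrite -[LHS]/(P ((fun t => [set i | b (X i t)]%SET) @^-1` [set J : {set 'I_n} | A #|J|])).
rewrite (probability_finite_sum _ mS) (@binomial_probE R n r r0 r1).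
under eq_bigr do rewrite (hit_set_probability _ mX indX Xr).
(* Since [#|J| <= n], [inord] preserves the cardinality, and the classes match the terms of the
   binomial sum one by one. *)
rewrite (partition_big (fun J : {set 'I_n} => inord #|J| : 'I_n.+1) xpredT)//=.
apply: eq_bigr => k _.
have cardJ (J : {set 'I_n}) : (inord #|J| == k :> 'I_n.+1) = (#|J| == k).
  by rewrite -val_eqE /= inordK// ltnS -[X in (_ <= X)%N]card_ord max_card.
(* The Dirac mass at [k] selects the sizes in [A]; for any other size the class of [J] is empty. *)
rewrite diracE; have [Ak|Ak] := pselect (A k).
  rewrite mem_set// mule1 sumEFin; congr EFin.
  rewrite (eq_bigl (mem [set J : {set 'I_n} | #|J| == k]%SET)); last first.
    move=> J; rewrite cardJ !inE; apply/andP/idP => [[]//|Jk]; split=> //.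
    by apply/mem_set; rewrite /= (eqP Jk).
  rewrite (eq_bigr (fun=> r ^+ k * (1 - r) ^+ (n - k))) => [|J].
    by rewrite sumr_const card_draws card_ord.
  by rewrite /= inE => /eqP ->.
rewrite memNset// mule0 big_pred0// => J; rewrite cardJ.
by apply/negP => /andP[/set_mem /= AJ /eqP Jk]; apply: Ak; rewrite -Jk.
Qed.

End finite_valued_random_elements.

(** * The minimal point of the grid and k-dominance *)

Section grid_minimum.
Context (d k : nat) (u : 'I_d -> nat).
Context (hk : (1 <= k <= d)%N) (hu : forall j, (0 < u j)%N).

(** Ordinals start at 0, so the constant value 0 encodes the point (1, ..., 1). *)
Definition grid_min : grid u := [ffun j => Ordinal (hu j)].

Lemma card_grid : #|grid u| = (\prod_(j < d) u j)%N.
Proof.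
rewrite card_dep_ffun foldrE big_map big_enum /=.
by apply: eq_bigr => j _; rewrite card_ord.
Qed.

Lemma grid_min_not_dominated (p : grid u) :
  ~~ kdominates k (grid_coord p) (grid_coord grid_min).
Proof.
apply/negP => /existsP[S /and3P[_ _ /existsP[j /andP[_]]]].
by rewrite /grid_coord ffunE.
Qed.

Lemma grid_min_dominates (p : grid u) : p != grid_min ->
  kdominates k (grid_coord grid_min) (grid_coord p).
Proof.
move=> pm; have [j pj] : exists j, (0 < p j)%N.
  apply/existsP; apply: contraNT pm; rewrite negb_exists => /forallP p0.
  apply/eqP/ffunP => j; apply/val_inj; rewrite ffunE /=.
  by apply/eqP; rewrite -leqn0 leqNgt; exact: p0.
have [k0 kd] := andP hk.
(* The witness [S] must contain the coordinate [j] of strict inequality: list all coordinates with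
   [j] first and keep the first [k], which include [j] because [k >= 1]. *)
pose s := j :: rem j (enum 'I_d).
have sE : perm_eq (enum 'I_d) s by apply: perm_to_rem; rewrite mem_enum.
have us : uniq (take k s) by apply: take_uniq; rewrite -(perm_uniq sE) enum_uniq.
have ss : size s = d by rewrite -(perm_size sE) size_enum_ord.
apply/existsP; exists [set i in take k s]%SET; apply/and3P; split.
- by rewrite cardsE (card_uniqP us) size_takel// ss.
- by apply/forallP => i; rewrite /grid_coord ffunE /= ltnS leq0n implybT.
- apply/existsP; exists j; rewrite inE /grid_coord ffunE /= ltnS pj andbT.
  by case: (k) k0 => // k' _; rewrite inE eqxx.
Qed.

(** A point other than the minimum is dominated by the occurrence at [l], whose index is then
    necessarily different; repeated occurrences of the minimum do not dominate each other. *)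
Lemma nb_knondominated_grid_min (n : nat) (q : 'I_n -> grid u) :
  (exists l, q l = grid_min) ->
  nb_knondominated k q = #|[set i | q i == grid_min]%SET|.
Proof.
move=> [l0 ql0]; rewrite /nb_knondominated; apply: eq_card => i.
rewrite !inE; apply/forallP/eqP => [nd|->]; last first.
  by move=> l; apply/implyP => _; exact: grid_min_not_dominated.
apply/eqP/negPn/negP => qi; have := nd l0.
rewrite ql0 grid_min_dominates// implybF negbK => /eqP l0i.
by rewrite -l0i ql0 eqxx in qi.
Qed.

End grid_minimum.

Unset Implicit Arguments.
Set Strict Implicit.

Theorem theorem5 (R : realType) (d k : nat) (u : 'I_d -> nat)
  (hd : (2 <= d)%N) (hk : (1 <= k <= d)%N) (hu : forall j : 'I_d, (2 <= u j)%N)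
  (* for each n, the n random points on a probability space of their own *)
  (disp : nat -> measure_display)
  (T : forall n : nat, measurableType (disp n))
  (P : forall n : nat, probability (T n) R)
  (p : forall n : nat, 'I_n -> T n -> grid u)
  (hmeas : forall (n : nat) (i : 'I_n), random_element (p n i))
  (hunif : forall (n : nat) (i : 'I_n), uniformly_distributed (P n) (p n i))
  (hindep : forall n : nat, mutually_independent (P n) (p n))
  (* for each n, a binomial random variable, possibly on another space *)
  (disp' : nat -> measure_display)
  (T' : forall n : nat, measurableType (disp' n))
  (Q : forall n : nat, probability (T' n) R)
  (X : forall n : nat, {RV (Q n) >-> nat})
  (hX : forall (n : nat) (A : set nat),
    distribution (Q n) (X n) A =
    binomial_prob n ((\prod_(j < d) u j)%N%:R^-1 : R) A) :
  ereal_sup [set (`| P n [set t | A (Posz (nb_knondominated k (fun i => p n i t)))]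
                   - Q n [set t | A (Posz (X n t))] |)%E
            | A in [set: set int]] @[n --> \oo] --> (0%:E : \bar R).
Proof.
have hu0 j : (0 < u j)%N by exact: ltn_trans (hu j).
pose m := grid_min hu0.
set r : R := (\prod_(j < d) u j)%N%:R^-1.
have u_gt0 : (0 < \prod_(j < d) u j)%N by apply/prodn_gt0.
have r_gt0 : 0 < r by rewrite invr_gt0 ltr0n.
have r_le1 : r <= 1 by rewrite invf_le1 ?ltr0n// ler1n.
have r01 : 0 <= r <= 1 by rewrite ltW.
have Pm n i : P n (p n i @^-1` [set` pred1 m]) = r%:E.
  rewrite /r -(card_grid u) -(hunif n i m); congr (P n _).
  by apply/seteqP; split=> t /= /eqP.
have mN n (B : set nat) : measurable [set t | B (nb_knondominated k (fun i => p n i t))].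
  have := random_element_joint (hmeas n)
    [set f | B (nb_knondominated k f)].
  congr measurable; apply/funext => t /=.
  by congr (B (nb_knondominated k _)); apply/funext => i; rewrite ffunE.
have mC n (B : set nat) : measurable [set t | B #|[set i | p n i t == m]%SET|].
  have := random_element_joint (hmeas n)
    [set f | B #|[set i | f i == m]%SET|].
  congr measurable; apply/funext => t /=.
  by congr (B _); apply: eq_card => i; rewrite !inE ffunE.
have bound n (A : set int) :
    (`| P n [set t | A (Posz (nb_knondominated k (fun i => p n i t)))]
       - Q n [set t | A (Posz (X n t))] | <= ((1 - r) ^+ n)%:E)%E.
  (* Only the law of [X n] matters, so it is replaced by the number of occurrences of [m] in the
     sample, which lives on the same space as the points. *)
  have -> : Q n [set t | A (Posz (X n t))] =
      P n [set t | A (Posz #|[set i | p n i t == m]%SET|)].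
    rewrite -[LHS]/(distribution (Q n) (X n) [set j | A (Posz j)]) hX.
    by rewrite -(hit_count_binomial _ r01 (hmeas n) (hindep n) (Pm n)).
  (* The bound is the probability that the hit set of [m] is empty. *)
  have -> : ((1 - r) ^+ n)%:E = P n [set t | [set i | p n i t == m]%SET = finset.set0].
    rewrite (hit_set_probability _ (hmeas n) (hindep n) (Pm n)).
    by rewrite cards0 expr0 mul1r subn0.
  have -> : [set t | [set i | p n i t == m]%SET = finset.set0] =
      [set t | #|[set i | p n i t == m]%SET| = 0%N].
    by apply/seteqP; split=> t /= => [->|/cards0_eq//]; rewrite cards0.
  apply: probability_dist_le.
  - exact: (mN n [set j | A (Posz j)]).
  - exact: (mC n [set j | A (Posz j)]).
  - exact: (mC n [set 0%N]).
  (* Once [m] occurs, the two counts coincide, so the two events agree off the exceptional set. *)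
  - have E t : #|[set i | p n i t == m]%SET| <> 0%N ->
        nb_knondominated k (fun i => p n i t) = #|[set i | p n i t == m]%SET|.
      move=> /eqP; rewrite cards_eq0 => /set0Pn[i]; rewrite inE => /eqP pi.
      by apply: nb_knondominated_grid_min => //; exists i.
    by apply/seteqP; split=> t /= [At Ct]; split=> //; move: At; rewrite E.
apply: (@squeeze_cvge _ _ _ _ (fun=> 0%E) _ (fun n => ((1 - r) ^+ n)%:E)).
- apply: nearW => n; apply/andP; split.
    (* Any member of the family, here the one at [set0], bounds the supremum below by a nonnegative
       value. *)
    apply: le_ereal_sup_tmp; eexists; first by exists set0.
    exact: abse_ge0.
  by apply: ge_ereal_sup => _ [A _ <-]; exact: bound.
- exact: cvg_cst.
- apply: cvg_EFin; first exact: nearW.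
  apply: cvg_expr; rewrite ger0_norm ?subr_ge0// ltrBlDr ltrDl//.
Qed.
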